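(* There exists an $O(\log|\mathcal{E}|)$-competitive online algorithm for ND with deadlines (with no guarantee on running time). In particular, there exists an $O(\log n)$-competitive online algorithm with deadlines for each of edge-weighted Steiner forest, strong edge-weighted Steiner forest, multicut, strong multicut, node-weighted Steiner forest, edge-weighted Steiner network, directed Steiner tree and facility location, where $n$ is the number of vertices of the input graph.
   Context: An instance of an (abstract) network design problem consists of a finite set $\mathcal{E}$ of elements with costs $c:\mathcal{E}\to\mathbb{R}^+$; each request $q$ is associated with an upward-closed family $X_q\subseteq 2^{\mathcal{E}}$, and a set $E\subseteq\mathcal{E}$ satisfies $q$ if $E\in X_q$. ND denotes a class of such problems. ND with deadlines: elements and costs known in advance; request $q$ is released at time $r_q$ with deadline $d_q$ revealed at release; at any time the algorithm may transmit $E\subseteq\mathcal{E}$ at cost $\sum_{e\in E}c(e)$, serving every pending request $q$ with $E\in X_q$; each request must be served within $[r_q,d_q]$; cost is total transmission cost. An algorithm is $\alpha$-competitive if its cost is always at most $\alpha$ times the optimal offline cost. The listed graph problems: Steiner forest (edges as elements, pair requests served by edge sets connecting the pair); strong Steiner forest (requests are vertex subsets that must lie in one component); multicut (edge sets are disrupted, pair request served if the pair is disconnected in $G$ minus the disrupted edges); strong multicut (vertex subsets that must become pairwise disconnected); node-weighted Steiner forest (vertices with costs as elements, pair served if connected in the induced subgraph); Steiner network (pair requests with demand $f(q)$, served by edge sets containing $f(q)$ edge-disjoint paths); directed Steiner tree (directed graph with root $\rho$, request $v$ served by edge sets containing a directed $\rho$-$v$ path); facility location (vertices with opening costs; opening a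 facility at $v$ and connecting pending requests $Q'$ costs $f(v)+\sum_{q\in Q'}\delta(v,q)$, $\delta$ the shortest-path metric). *)

(* Defs.v *)
From HB Require Import structures.
From mathcomp Require Import all_boot all_order all_algebra.
From mathcomp Require Import all_classical all_reals all_analysis.

Set Implicit Arguments.
Unset Strict Implicit.
Unset Printing Implicit Defensive.

Import Order.TTheory GRing.Theory Num.Theory.
Import numFieldNormedType.Exports.

Local Open Scope ring_scope.

(** * Online problems with deadlines *)

Record timed (R : realType) (Q : Type) := Timed {
  what : Q;
  release : R;
  deadline : R }.

Definition in_window (R : realType) (Q : Type) (q : timed R Q) (t : R) : bool :=
  release q <= t <= deadline q.

(** An input is the finite list of all requests; a schedule is the list of
    all actions taken, with their times. *)
Record problem (R : realType) := Problem {
  request : Type;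
  action : Type;
  feasible : seq (timed R request) -> seq (R * action) -> Prop;
  cost : seq (timed R request) -> seq (R * action) -> R }.

Section Competitive.
Variables (R : realType) (P : problem R).

Definition input : Type := seq (timed R (request P)).
Definition schedule : Type := seq (R * action P).
Definition algorithm : Type := input -> schedule.

(** Inputs are listed by order of release, so that the position of a request
    in the list is known when the request is released. *)
Definition chronological (I : input) : Prop :=
  sorted (fun p q => release p <= release q) I.

Definition revealed (t : R) (I : input) : input :=
  [seq q <- I | release q <= t].

Definition actions_until (t : R) (s : schedule) : schedule :=
  [seq x <- s | x.1 <= t].

(** Non-anticipation: what is done up to time t, time t included, is determined
    by the requests released up to time t; nothing else is asked (the algorithm
    may use unbounded computation). *)
Definition online (A : algorithm) : Prop :=
  forall (I J : input) (t : R), chronological I -> chronological J ->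
    revealed t I = revealed t J ->
    actions_until t (A I) = actions_until t (A J).

Definition opt (I : input) : R :=
  inf [set cost I s | s in [set s : schedule | feasible I s]]%classic.

(** Inputs that even an offline algorithm cannot serve are excluded: for those
    there is no offline optimum to compare with. *)
Definition competitive (a : R) (A : algorithm) : Prop :=
  forall I : input, chronological I -> (exists s : schedule, feasible I s) ->
    feasible I (A I) /\ cost I (A I) <= a * opt I.

End Competitive.

(** The class of problems [P I], where [I] ranges over [Inst], admits an
    O(log (size I))-competitive online algorithm. The description [I] of the
    ground structure is known in advance; the ratio is finite for every value
    of [size I], also when the logarithm vanishes. *)
Definition log_competitive (R : realType) (Inst : Type)
    (P : Inst -> problem R) (size : Inst -> nat) : Prop :=
  exists alpha : nat -> R,
    (alpha =O_\oo (fun n : nat => ln n%:R : R))%classic /\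
    exists A : forall I : Inst, algorithm (P I),
      forall I : Inst, online (A I) /\ competitive (alpha (size I)) (A I).

(** * Network design *)

(** [nd_request] collects the requests that may be released in the problem at
    hand, so a class of network design problems is a family of such records;
    taking for [nd_request] all upward-closed families gives the general one. *)
Record ND_instance (R : realType) := NDInstance {
  elt : finType;
  elt_cost : elt -> R;
  elt_cost_ge0 : forall e, 0 <= elt_cost e;
  nd_request : Type;
  sat : nd_request -> {set elt} -> Prop;
  sat_up : forall q (E F : {set elt}), E \subset F -> sat q E -> sat q F }.

Definition ND_feasible (R : realType) (N : ND_instance R)
    (I : seq (timed R (nd_request N))) (s : seq (R * {set elt N})) : Prop :=
  forall i q, onth I i = Some q ->
    exists x, [/\ x \in s, in_window q x.1 & sat (what q) x.2].

Definition ND_cost (R : realType) (N : ND_instance R)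
    (I : seq (timed R (nd_request N))) (s : seq (R * {set elt N})) : R :=
  \sum_(x <- s) \sum_(e in x.2) elt_cost e.

Definition ND (R : realType) (N : ND_instance R) : problem R :=
  Problem (@ND_feasible R N) (@ND_cost R N).

(** * Graphs *)

Record sgraph := SGraph {
  vertex :> finType;
  adj : rel vertex;
  adj_sym : symmetric adj;
  adj_irr : irreflexive adj }.

Definition edges (G : sgraph) : {set {set G}} :=
  [set e : {set G} | [exists x, exists y, adj x y && (e == [set x; y])]]%SET.

Definition edge (G : sgraph) : finType := {e : {set G} | e \in edges G}.

(** Adjacency in the spanning subgraph of G with edge set F. *)
Definition adj_in (G : sgraph) (F : {set edge G}) : rel G :=
  fun x y => [exists e in F, val e == [set x; y]%SET].

Record weighted_graph (R : realType) := WeightedGraph {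
  wgraph :> sgraph;
  weight : edge wgraph -> R;
  weight_ge0 : forall e, 0 <= weight e }.

Record node_weighted_graph (R : realType) := NodeWeightedGraph {
  nwgraph :> sgraph;
  node_weight : nwgraph -> R;
  node_weight_ge0 : forall v, 0 <= node_weight v }.

Definition arc (V : finType) (a : rel V) : finType := {x : V * V | a x.1 x.2}.

Record rooted_digraph (R : realType) := RootedDigraph {
  dvertex :> finType;
  darc : rel dvertex;
  droot : dvertex;
  arc_weight : arc darc -> R;
  arc_weight_ge0 : forall a, 0 <= arc_weight a }.

(** The edges traversed when following the vertices of p from u. *)
Definition path_edges (V : finType) (u : V) (p : seq V) : seq {set V} :=
  [seq [set x.1; x.2]%SET | x <- zip (u :: p) p].

(** * Satisfaction predicates of the graph problems *)

Definition pair_connected (G : sgraph) (q : G * G) (F : {set edge G}) : Prop :=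
  connect (adj_in F) q.1 q.2.

Definition set_connected (G : sgraph) (S : {set G}) (F : {set edge G}) : Prop :=
  {in S &, forall u v, connect (adj_in F) u v}.

Definition pair_cut (G : sgraph) (q : G * G) (F : {set edge G}) : Prop :=
  ~~ connect (adj_in (~: F)%SET) q.1 q.2.

Definition set_cut (G : sgraph) (S : {set G}) (F : {set edge G}) : Prop :=
  {in S &, forall u v, u != v -> ~~ connect (adj_in (~: F)%SET) u v}.

Definition induced_adj (G : sgraph) (U : {set G}) : rel G :=
  fun x y => [&& x \in U, y \in U & adj x y].

Definition pair_connected_induced (G : sgraph) (q : G * G) (U : {set G}) : Prop :=
  [/\ q.1 \in U, q.2 \in U & connect (induced_adj U) q.1 q.2].

(** A request ((u, v), k) asks for k pairwise edge-disjoint u-v paths. *)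
Definition edge_disjoint_paths (G : sgraph) (q : (G * G) * nat)
    (F : {set edge G}) : Prop :=
  let: ((u, v), k) := q in
  exists p : 'I_k -> seq G,
    (forall i, [/\ path (adj_in F) u (p i), last u (p i) = v & uniq (u :: p i)]) /\
    (forall i j, i != j ->
       [disjoint path_edges u (p i) & path_edges u (p j)]).

Definition arc_in (V : finType) (a : rel V) (F : {set arc a}) : rel V :=
  fun x y => [exists e in F, val e == (x, y)].

Definition reached_from_root (R : realType) (D : rooted_digraph R) (v : D)
    (F : {set arc (@darc R D)}) : Prop :=
  connect (arc_in F) (droot D) v.

Section Monotonicity.
Variable G : sgraph.
Implicit Types (E F : {set edge G}) (U W : {set G}).

Lemma adj_in_sub E F : E \subset F -> subrel (adj_in E) (adj_in F).
Proof.
move=> /fintype.subsetP EF x y /existsP[e /andP[eE exy]].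
by apply/existsP; exists e; rewrite EF.
Qed.

Lemma connect_adj_in_sub E F u v :
  E \subset F -> connect (adj_in E) u v -> connect (adj_in F) u v.
Proof.
move=> EF; apply: connect_sub => x y /(adj_in_sub EF); exact: connect1.
Qed.

Lemma pair_connected_up q E F :
  E \subset F -> pair_connected q E -> pair_connected q F.
Proof. exact: connect_adj_in_sub. Qed.

Lemma set_connected_up S E F :
  E \subset F -> set_connected S E -> set_connected S F.
Proof. by move=> EF ES u v uS vS; apply: connect_adj_in_sub (ES _ _ uS vS). Qed.

Lemma pair_cut_up q E F : E \subset F -> pair_cut q E -> pair_cut q F.
Proof.
by move=> EF; apply: contra; apply: connect_adj_in_sub; rewrite finset.setCS.
Qed.

Lemma set_cut_up S E F : E \subset F -> set_cut S E -> set_cut S F.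
Proof.
move=> EF ES u v uS vS uv; apply: contra (ES u v uS vS uv).
by apply: connect_adj_in_sub; rewrite finset.setCS.
Qed.

Lemma pair_connected_induced_up q U W :
  U \subset W -> pair_connected_induced q U -> pair_connected_induced q W.
Proof.
move=> /fintype.subsetP UW [q1 q2 q12]; split; [exact: UW|exact: UW|].
apply: connect_sub q12 => x y /and3P[xU yU xy].
by apply: connect1; rewrite /induced_adj !UW.
Qed.

Lemma edge_disjoint_paths_up q E F :
  E \subset F -> edge_disjoint_paths q E -> edge_disjoint_paths q F.
Proof.
case: q => [[u v] k] EF [p [pP pD]]; exists p; split=> // i.
by have [pi li ui] := pP i; split=> //; apply: sub_path pi; apply: adj_in_sub.
Qed.

End Monotonicity.

Lemma reached_from_root_up (R : realType) (D : rooted_digraph R) (v : D)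
    (E F : {set arc (@darc R D)}) :
  E \subset F -> reached_from_root v E -> reached_from_root v F.
Proof.
move=> /fintype.subsetP EF; apply: connect_sub => x y /existsP[e /andP[eE exy]].
by apply: connect1; apply/existsP; exists e; rewrite EF.
Qed.

(** * The graph problems *)

Section GraphProblems.
Variable R : realType.

Definition steiner_forest (G : weighted_graph R) : problem R :=
  ND (NDInstance (@weight_ge0 R G) (@pair_connected_up G)).

Definition strong_steiner_forest (G : weighted_graph R) : problem R :=
  ND (NDInstance (@weight_ge0 R G) (@set_connected_up G)).

Definition multicut (G : weighted_graph R) : problem R :=
  ND (NDInstance (@weight_ge0 R G) (@pair_cut_up G)).

Definition strong_multicut (G : weighted_graph R) : problem R :=
  ND (NDInstance (@weight_ge0 R G) (@set_cut_up G)).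

Definition node_weighted_steiner_forest (G : node_weighted_graph R) : problem R :=
  ND (NDInstance (@node_weight_ge0 R G) (@pair_connected_induced_up G)).

Definition steiner_network (G : weighted_graph R) : problem R :=
  ND (NDInstance (@weight_ge0 R G) (@edge_disjoint_paths_up G)).

Definition directed_steiner_tree (D : rooted_digraph R) : problem R :=
  ND (NDInstance (@arc_weight_ge0 R D) (@reached_from_root_up R D)).

End GraphProblems.

(** * Facility location *)

Record facility_graph (R : realType) := FacilityGraph {
  fgraph :> weighted_graph R;
  opening_cost : fgraph -> R;
  opening_cost_ge0 : forall v, 0 <= opening_cost v }.

(** Sum of the weights of the edges of a walk; the default value [0] is never
    used on a walk of [G]. *)
Definition walk_weight (R : realType) (G : weighted_graph R) (u : G)
    (p : seq G) : R :=
  \sum_(e <- path_edges u p) oapp (@weight R G) 0 (insub e).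

(** Shortest-path distance, meaningful when [u] and [v] are in the same
    component of [G] (otherwise the distance should be infinite, and [inf] of
    the empty set is [0]; [FL_feasible] below excludes this case). *)
Definition dist (R : realType) (G : weighted_graph R) (u v : G) : R :=
  inf [set walk_weight u p | p in
        [set p : seq G | path (@adj G) u p /\ last u p = v]]%classic.

(** The action (v, S) opens a facility at v and connects to it the requests
    whose positions in the input are listed in S. Each request is connected
    exactly once, within its window, and only to a facility at finite
    distance. *)
Definition FL_feasible (R : realType) (G : facility_graph R)
    (I : seq (timed R G)) (s : seq (R * (G * seq nat))) : Prop :=
  perm_eq (flatten [seq x.2.2 | x <- s]) (iota 0 (size I)) /\
  forall x i q, x \in s -> i \in x.2.2 -> onth I i = Some q ->
    in_window q x.1 /\ connect (@adj G) x.2.1 (what q).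

(** In a feasible schedule every listed position is valid, so that the default
    value of [nth] plays no role. *)
Definition FL_cost (R : realType) (G : facility_graph R)
    (I : seq (timed R G)) (s : seq (R * (G * seq nat))) : R :=
  \sum_(x <- s) (opening_cost x.2.1 +
    \sum_(i <- x.2.2) dist x.2.1 (nth x.2.1 [seq what q | q <- I] i)).

Definition facility_location (R : realType) (G : facility_graph R) : problem R :=
  Problem (@FL_feasible R G) (@FL_cost R G).

(* Main.v *)
Require Import Defs.
From HB Require Import structures.
From mathcomp Require Import all_boot all_order all_algebra.
From mathcomp Require Import all_classical all_reals all_analysis.
From mathcomp Require Import lra zify.

(* Every pending request has a level j, at first the least such that it can be
   served alone at cost [scale j]. When a request of level j reaches its deadline,
   a service of level j buys all elements of cost at most [scale j] / (n + 1), where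
   n is the number of elements, and then serves the pending requests of level at
   most j in order of deadline, as far as a budget of order [scale j] permits. The
   requests left out move up to level j + 1.

   Consider a service of level j, started by a request q, and the time since the
   previous service of level at least j. In that period the offline solution
   itself pays of the order of [scale j]: either q still has its first level and is
   that expensive alone, or q was postponed by a service of level j - 1, and the
   requests handled there, all released in that period and due before q, are that
   expensive together. The elements of cost below [scale j] / (4(n + 1)) contribute
   only a fraction to this amount, so an element of cost c is charged in full at
   O(log n) scales and with geometrically decreasing amounts at the lower ones.

   Facility location is covered by letting a request pay, besides the elements, a
   connection cost that depends on the set bought. The number of requests is not
   bounded in terms of the graph, so connections cannot be elements; but the
   connection of a request is charged only on behalf of the service that serves
   it, hence O(1) times. *)

Set Implicit Arguments.
Unset Strict Implicit.
Unset Printing Implicit Defensive.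

Import Order.TTheory GRing.Theory Num.Theory.
Import numFieldNormedType.Exports.

Local Open Scope ring_scope.

(** * Geometric scales *)

Section ScaleSums.
Variable R : realType.
Implicit Types (a b c : R) (K m : nat).

(** Partial sums of the geometric series stay below the next term, so the terms up to [c] add up to
    at most twice the largest of them. *)
Lemma sum_scales_below a c K : 0 <= a -> 0 <= c ->
  \sum_(j < K | a * 2 ^+ j <= c) a * 2 ^+ j <= 2 * c.
Proof.
move=> a0 c0.
have full k : \sum_(j < k) a * 2 ^+ j <= a * 2 ^+ k.
  elim: k => [|k IH]; first by rewrite big_ord0 expr0 mulr1.
  rewrite big_ord_recr exprS /=; lra.
elim: K => [|K IH]; first by rewrite big_ord0; lra.
have [le|lt] := leP (a * 2 ^+ K) c; last first.
  by rewrite big_mkcond big_ord_recr /= (lt_geF lt) addr0 -big_mkcond.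
apply: le_trans (_ : a * 2 ^+ K.+1 <= _); last by rewrite exprS; lra.
apply: le_trans (full K.+1); rewrite big_mkcond; apply: ler_sum => j _.
by case: ifP => // _; rewrite mulr_ge0 ?exprn_ge0.
Qed.

Lemma count_scales_octave a b K : 0 < a -> 0 < b ->
  (\sum_(j < K | (b <= a * 2 ^+ j < 2 * b)%R) 1 <= 1)%N.
Proof.
move=> a0 b0; elim: K => [|K IH]; first by rewrite big_ord0.
rewrite big_mkcond big_ord_recr -big_mkcond /=.
case: ifP => [/andP[_ lt]|_]; last by rewrite addn0.
rewrite big1 // => j /andP[le _]; exfalso.
have : a * 2 ^+ j.+1 <= a * 2 ^+ K.
  by rewrite ler_pM2l // ler_weXn2l // ler1n.
rewrite exprS; lra.
Qed.

Lemma count_scales a c K m : 0 < a -> 0 < c ->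
  (\sum_(j < K | (c <= a * 2 ^+ j < 2 ^+ m * c)%R) 1 <= m)%N.
Proof.
move=> a0 c0; elim: m => [|m IH].
  by rewrite big1 // => j; rewrite expr0 mul1r => /andP[]; rewrite leNgt => /negP.
have m0 : (0 : R) < 2 ^+ m by rewrite exprn_gt0.
rewrite -[leqRHS]addn1 (bigID (fun j : 'I_K => a * 2 ^+ j < 2 ^+ m * c)) /=.
apply: leq_add.
  apply: leq_trans IH; rewrite big_mkcond [leqRHS]big_mkcond.
  apply: leq_sum => j _; case: (_ <= _); case: (_ < 2 ^+ m * c);
    by rewrite //= ?andbF //=; case: (_ < _).
have p0 : 0 < 2 ^+ m * c by rewrite mulr_gt0.
apply: leq_trans (count_scales_octave K a0 p0).
rewrite big_mkcond [leqRHS]big_mkcond; apply: leq_sum => j _.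
rewrite exprS -mulrA -leNgt.
by case: (_ <= _) => //=; case: (_ < _); case: (_ <= _).
Qed.

(** This is where the logarithm arises: the scales up to [c] contribute a geometric sum, and at most
    [m] scales lie between [c] and [N * c], each contributing [c]. *)
Lemma sum_scales a c K m (N : R) : 0 < a -> 0 <= c -> N <= 2 ^+ m ->
  \sum_(j < K | a * 2 ^+ j < N * c) Num.min c (a * 2 ^+ j) <= (2 + m%:R) * c.
Proof.
move=> a0; rewrite le_eqVlt => /predU1P[<- _|c0 Nm].
  by rewrite big1 ?mulr0 // => j; rewrite ?mulr0 ltNge mulr_ge0 ?exprn_ge0 // ltW.
have cnt := count_scales K m a0 c0.
rewrite mulrDl; apply: le_trans (lerD (sum_scales_below K (ltW a0) (ltW c0)) (lexx _)).
apply: le_trans (_ : _ <= \sum_(j < K | a * 2 ^+ j <= c) a * 2 ^+ j +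
   \sum_(j < K | c <= a * 2 ^+ j < 2 ^+ m * c) c) _; last first.
  rewrite lerD2l // sumr_const -(mulr_natl c) ler_pM2r // ler_nat.
  by move: cnt; rewrite sum1_card.
rewrite big_mkcond [X in _ <= X + _]big_mkcond [X in _ <= _ + X]big_mkcond -big_split.
apply: ler_sum => j _ /=.
have aj : 0 < a * 2 ^+ j by rewrite mulr_gt0 ?exprn_gt0.
have Nc : N * c <= 2 ^+ m * c by rewrite ler_pM2r.
rewrite minElt.
do !case: ifP => //; rewrite ?addr0 ?add0r //; try lra; move=> *; nra.
Qed.

End ScaleSums.

(** * Services by level *)

Section Services.
Variables (R : realType) (E : finType) (c : E -> R) (X : choiceType).
Variables (arr due : X -> R) (sat : X -> {set E} -> Prop).
Variables (conn : X -> {set E} -> R) (theta : R).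
Implicit Types (S T : {set E}) (Q : seq X) (P : seq (X * nat)) (j n K : nat).
Implicit Types (x y : X) (t : R).

Definition set_cost S : R := \sum_(e in S) c e.

Definition scale j : R := theta * 2 ^+ j.

Definition light j : {set E} := [set e | #|E|.+1%:R * c e <= scale j]%SET.

Definition heavy_cost j S : R :=
  \sum_(e in S | scale j < #|E|.+1%:R * c e) c e.

(** What a service of level [j] costs beyond the light elements, which it buys in any case. *)
Definition residual j S Q : R := heavy_cost j S + \sum_(x <- Q) conn x S.

Definition serves S Q : Prop := forall x, x \in Q -> sat x S.

(* [x] triggers the service, [A] lists the requests that it may serve. The last
   clause is what pays for a later service triggered by a request left out. *)
Definition service_choice (A : seq X) x j (o : {set E} * seq X) : Prop :=
  [/\ [/\ x \in o.2, subseq o.2 A & serves o.1 o.2],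
      residual j o.1 o.2 <= 2 * scale j &
      forall y, y \in A -> y \notin o.2 ->
        (forall z, z \in o.2 -> due z <= due y) /\
        (forall S, serves S o.2 -> scale j < residual j S o.2)].

Definition choose_service (A : seq X) x j : {set E} * seq X :=
  xget (finset.set0, [::]) [set o | service_choice A x j o]%classic.

Definition is_eligible t j (p : X * nat) : bool := (arr p.1 <= t) && (p.2 <= j)%N.

Definition eligible t j P : seq X := [seq p.1 | p <- P & is_eligible t j p].

(** A request left out jumps straight to level [j.+1], even from below [j]; afterwards every request
    of level at most [j] has a release time after [t]. *)
Definition postpone t j Q P : seq (X * nat) :=
  [seq (p.1, if is_eligible t j p then j.+1 else p.2) | p <- P & p.1 \notin Q].

(* The state [P] lists the pending requests by deadline, future ones included,
   each with its level. A service (t, (S, Q)) buys S at time t to serve Q. *)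
Fixpoint run n P : seq (R * ({set E} * seq X)) :=
  if n is n'.+1 then if P is p :: P' then
    let t := due p.1 in
    let o := choose_service (eligible t p.2 P) p.1 p.2 in
    (t, (light p.2 :|: o.1, o.2)%SET) :: run n' (postpone t p.2 o.2 P')
  else [::] else [::].

Definition by_due P : bool := sorted (fun p q => due p.1 <= due q.1) P.

Definition by_due_trans : transitive (fun p q : X * nat => due p.1 <= due q.1).
Proof. by move=> p q r; apply: le_trans. Qed.

Lemma by_due_min p P : by_due (p :: P) -> {in P, forall q, due p.1 <= due q.1}.
Proof.
by rewrite /by_due /= => /(order_path_min by_due_trans) /allP h q /h.
Qed.

Lemma map_fst_postpone t j Q P :
  [seq p.1 | p <- postpone t j Q P] = [seq x <- [seq p.1 | p <- P] | x \notin Q].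
Proof. by rewrite -map_comp filter_map. Qed.

Lemma postpone_by_due t j Q P : by_due P -> by_due (postpone t j Q P).
Proof.
move=> sP; rewrite /by_due sorted_map.
exact: sorted_filter by_due_trans _ _ sP.
Qed.

(** * Non-anticipation of the run *)

Lemma run_after n P t : (forall p, p \in P -> t < due p.1) ->
  {in run n P, forall s, t < s.1}.
Proof.
elim: n P => [|n IH] [|p P] //= late s; rewrite inE => /predU1P[->|].
  by apply: late; rewrite mem_head.
apply: IH => q /mapP[r]; rewrite mem_filter => /andP[_ rP] ->.
by apply: (late r); rewrite inE rP orbT.
Qed.

Lemma filter_eligible t d j P : d <= t ->
  eligible d j P = eligible d j [seq p <- P | arr p.1 <= t].
Proof.
move=> dt; rewrite /eligible -filter_predI; congr map; apply: eq_filter => p /=.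
rewrite /is_eligible; case: (leP (arr p.1) d) => //= pd.
by rewrite (le_trans pd dt) andbT.
Qed.

Lemma filter_postpone t d j Q P :
  [seq p <- postpone d j Q P | arr p.1 <= t] =
  postpone d j Q [seq p <- P | arr p.1 <= t].
Proof.
rewrite /postpone filter_map -!filter_predI; congr map; apply: eq_filter => p /=.
by rewrite andbC.
Qed.

(** A request released after [t] is due after [t], so it triggers no service by time [t]. As long as
    a head is due by [t], both states have the same head and the same eligible requests. The fuels
    differ because they also count the requests still to come. *)
Lemma run_online n n' P P' t :
  (size P <= n)%N -> (size P' <= n')%N -> by_due P -> by_due P' ->
  (forall p, p \in P -> arr p.1 <= due p.1) ->
  (forall p, p \in P' -> arr p.1 <= due p.1) ->
  [seq p <- P | arr p.1 <= t] = [seq p <- P' | arr p.1 <= t] ->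
  [seq s <- run n P | s.1 <= t] = [seq s <- run n' P' | s.1 <= t].
Proof.
have quiet m (L : seq (X * nat)) : (forall p, p \in L -> t < due p.1) ->
    [seq s <- run m L | s.1 <= t] = [::].
  move=> /run_after late; rewrite -(filter_pred0 (run m L)).
  by apply: eq_in_filter => s /late; rewrite ltNge => /negbTE.
have head (q : X * nat) L : by_due (q :: L) -> t < due q.1 ->
    forall p, p \in q :: L -> t < due p.1.
  move=> sL late p; rewrite inE => /predU1P[->//|/(by_due_min sL)].
  exact: lt_le_trans.
have unreleased m (L : seq (X * nat)) : (forall p, p \in L -> arr p.1 <= due p.1) ->
    [seq p <- L | arr p.1 <= t] = [::] -> [seq s <- run m L | s.1 <= t] = [::].
  move=> adL eq0; apply: quiet => p pL; rewrite ltNge; apply/negP => pt.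
  have : p \in [seq p <- L | arr p.1 <= t].
    by rewrite mem_filter pL (le_trans (adL p pL) pt).
  by rewrite eq0.
elim: n n' P P' => [|n IH] n' P P'.
  by case: P => // _ _ _ _ _ ad' /esym eq0; rewrite (unreleased n').
case: P => [|p P]; first by move=> _ _ _ _ _ ad' /esym eq0; rewrite (unreleased n').
move=> szP szP' sP sP' ad ad' eqF.
have [tp|pt] := ltP t (due p.1).
  rewrite (quiet _ _ (head _ _ sP tp)); apply/esym/quiet => q qP'.
  rewrite ltNge; apply/negP => qt.
  have : q \in [seq p <- P' | arr p.1 <= t].
    by rewrite mem_filter qP' (le_trans (ad' q qP') qt).
  by rewrite -eqF mem_filter => /andP[_ /(head _ _ sP tp)]; rewrite ltNge qt.
have pa : arr p.1 <= t by apply: le_trans (ad _ (mem_head _ _)) pt.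
case: P' szP' sP' ad' eqF => [|p' P'] szP' sP' ad' eqF.
  by move: eqF; rewrite /= pa.
case: n' szP' => // n' szP'.
have pP' : p \in p' :: P'.
  have : p \in [seq p <- p' :: P' | arr p.1 <= t] by rewrite -eqF /= pa mem_head.
  by rewrite mem_filter => /andP[].
have p't : due p'.1 <= t.
  by move: pP'; rewrite inE => /predU1P[<-//|/(by_due_min sP') /le_trans]; apply.
have p'a : arr p'.1 <= t by apply: le_trans (ad' _ (mem_head _ _)) p't.
(* Both heads are released by [t], so each is the first element of the common filtered list. *)
have eqF' := eqF; move: eqF'; rewrite /= pa p'a => -[pp' eqT]; subst p'.
rewrite (filter_eligible _ _ pt) eqF -(filter_eligible _ _ pt).
rewrite /= pt; congr cons.
apply: IH; rewrite ?postpone_by_due //.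
- rewrite size_map size_filter; exact: leq_trans (count_size _ _) (ltnSE szP).
- rewrite size_map size_filter; exact: leq_trans (count_size _ _) (ltnSE szP').
- exact: path_sorted sP.
- exact: path_sorted sP'.
- move=> q /mapP[r]; rewrite mem_filter => /andP[_ rP] -> /=.
  by apply: (ad r); rewrite inE rP orbT.
- move=> q /mapP[r]; rewrite mem_filter => /andP[_ rP] -> /=.
  by apply: (ad' r); rewrite inE rP orbT.
- by rewrite !filter_postpone eqT.
Qed.

(** * Existence and feasibility of services *)

Hypothesis c_ge0 : forall e, 0 <= c e.
Hypothesis conn_ge0 : forall x S, 0 <= conn x S.
Hypothesis sat_mono : forall x S T, S \subset T -> sat x S -> sat x T.
Hypothesis conn_anti : forall x S T,
  S \subset T -> sat x S -> conn x T <= conn x S.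
Hypothesis theta_gt0 : 0 < theta.

Lemma set_cost_ge0 S : 0 <= set_cost S.
Proof. by apply: sumr_ge0 => e _; apply: c_ge0. Qed.

Lemma scale_gt0 j : 0 < scale j.
Proof. by rewrite mulr_gt0 ?exprn_gt0. Qed.

Lemma scaleS j : scale j.+1 = 2 * scale j.
Proof. by rewrite /scale exprS; lra. Qed.

Lemma leq_scale i j : (i <= j)%N -> scale i <= scale j.
Proof. by move=> ij; rewrite ler_pM2l // ler_weXn2l // ler1n. Qed.

Lemma sum_setU_le (f : E -> R) (a : pred E) S T : (forall e, 0 <= f e) ->
  \sum_(e in S :|: T | a e) f e <=
  \sum_(e in S | a e) f e + \sum_(e in T | a e) f e.
Proof.
move=> f0; rewrite big_mkcond [X in _ <= X + _]big_mkcond.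
rewrite [X in _ <= _ + X]big_mkcond -big_split; apply: ler_sum => e _ /=.
by rewrite finset.in_setU; case: (e \in S); case: (e \in T); case: (a e) => //=;
  have := f0 e; lra.
Qed.

Lemma heavy_cost_le j S : heavy_cost j S <= set_cost S.
Proof.
rewrite /heavy_cost /set_cost big_mkcondr; apply: ler_sum => e _.
by case: ifP.
Qed.

Lemma set_cost_light j S : set_cost (light j :|: S) <= scale j + heavy_cost j S.
Proof.
have lightE : \sum_(e in light j) c e <= scale j.
  apply: le_trans (_ : \sum_(e : E) scale j / #|E|.+1%:R <= _).
    rewrite big_mkcond; apply: ler_sum => e _; rewrite inE.
    by case: ifP; rewrite ?divr_ge0 ?(ltW (scale_gt0 j)) // ler_pdivlMr // mulrC.
  rewrite sumr_const -[_ *+ _]mulr_natl mulrA ler_pdivrMr // mulrC.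
  by rewrite ler_pM2l ?scale_gt0 // ler_nat.
apply: le_trans (lerD lightE (lexx _)).
rewrite /set_cost /heavy_cost big_mkcond [X in _ <= X + _]big_mkcond.
rewrite [X in _ <= _ + X]big_mkcond -big_split; apply: ler_sum => e _ /=.
rewrite !inE ltNge; case: (_ <= scale j) => /=; case: (e \in S) => /=;
  by have := c_ge0 e; lra.
Qed.

Definition affordable j x : Prop :=
  exists S, sat x S /\ set_cost S + conn x S <= scale j.

Definition well_formed P : Prop :=
  [/\ uniq [seq p.1 | p <- P], by_due P &
      forall p, p \in P -> arr p.1 <= due p.1 /\ affordable p.2 p.1].

(** Requests are added in order of deadline while the prefix is [cheap]. The first one that would
    make it expensive is still included, by adding a set that serves it alone: this at most doubles
    the budget, and the list served is then itself expensive, as the last clause demands. *)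
Lemma service_choice_exists A x j :
  sorted (fun y z => due y <= due z) (x :: A) ->
  (forall y, y \in x :: A -> affordable j y) ->
  exists o, service_choice (x :: A) x j o.
Proof.
move=> sA affA.
pose cheap Q := exists S, serves S Q /\ residual j S Q <= scale j.
have due_trans : transitive (fun y z => due y <= due z).
  by move=> ? ? ?; apply: le_trans.
have grow B Q : x :: A = Q ++ B -> x \in Q -> cheap Q ->
    exists o, service_choice (x :: A) x j o.
  elim: B Q => [|y B IH] Q eqA xQ chQ.
    have [S [satS resS]] := chQ; exists (S, Q); split.
    - by split=> //; rewrite eqA cats0.
    - by apply: le_trans resS _; have := scale_gt0 j; lra.
    - by move=> z; rewrite eqA cats0 => ->.
  have [chQy|expQy] := pselect (cheap (rcons Q y)).
    by apply: IH chQy; rewrite ?cat_rcons // mem_rcons inE xQ orbT.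
  have [S [satS resS]] := chQ.
  have [|T [satT costT]] := affA y; first by rewrite eqA mem_cat mem_head orbT.
  exists (S :|: T, rcons Q y)%SET; split.
  - split.
    + by rewrite /= mem_rcons inE xQ orbT.
    + by rewrite eqA -cat_rcons prefix_subseq.
    + move=> z /=; rewrite mem_rcons inE => /predU1P[->|/satS].
        by apply: sat_mono satT; exact: finset.subsetUr.
      by apply: sat_mono; exact: finset.subsetUl.
  - have hU : heavy_cost j (S :|: T) <= heavy_cost j S + heavy_cost j T.
      exact: sum_setU_le.
    have hT := heavy_cost_le j T.
    have cT : conn y (S :|: T) <= conn y T.
      by apply: conn_anti satT; exact: finset.subsetUr.
    have cQ : \sum_(z <- Q) conn z (S :|: T) <= \sum_(z <- Q) conn z S.
      rewrite big_seq [leRHS]big_seq; apply: ler_sum => z /satS.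
      by apply: conn_anti; exact: finset.subsetUl.
    move: resS; rewrite /residual -cats1 big_cat big_seq1 /=; lra.
  - move=> z zA /= zQ; split=> [u uQ|S' satS'].
      move: sA; rewrite eqA -cat_rcons sorted_pairwise // pairwise_cat.
      case/and3P => /allrelP h _ _; apply: h => //.
      by move: zA; rewrite eqA -cat_rcons mem_cat (negbTE zQ).
    by rewrite ltNge; apply/negP => le; apply: expQy; exists S'.
apply: (grow A [:: x]) => //; first exact: mem_head.
have [|S [satS costS]] := affA x; first exact: mem_head.
exists S; split; first by move=> y; rewrite inE => /eqP ->.
rewrite /residual big_seq1; have := heavy_cost_le j S; lra.
Qed.

Definition head_service p P : {set E} * seq X :=
  choose_service (eligible (due p.1) p.2 (p :: P)) p.1 p.2.

Lemma head_serviceP p P : well_formed (p :: P) ->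
  service_choice (eligible (due p.1) p.2 (p :: P)) p.1 p.2 (head_service p P).
Proof.
move=> [_ sP wfP]; apply: xgetPex.
have pe : is_eligible (due p.1) p.2 p.
  by rewrite /is_eligible leqnn andbT; have [] := wfP _ (mem_head _ _).
have eqE : eligible (due p.1) p.2 (p :: P) = p.1 :: eligible (due p.1) p.2 P.
  by rewrite /eligible /= pe.
rewrite eqE; apply: service_choice_exists; rewrite -eqE.
  by rewrite sorted_map; apply: sorted_filter sP; exact: by_due_trans.
move=> y /mapP[q]; rewrite mem_filter => /andP[/andP[_ qj] /wfP[_ [S [satS le]]] ->].
by exists S; split=> //; apply: le_trans le (leq_scale qj).
Qed.

Lemma mem_postpone t j Q P q : q \in postpone t j Q P ->
  exists2 p, p \in P & p.1 \notin Q /\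
    q = (p.1, if is_eligible t j p then j.+1 else p.2).
Proof. by move=> /mapP[p]; rewrite mem_filter => /andP[pQ pP] ->; exists p. Qed.

Lemma well_formed_postpone p P t j Q :
  well_formed (p :: P) -> well_formed (postpone t j Q P).
Proof.
move=> [/= /andP[_ uP] sP wfP]; split.
- by rewrite map_fst_postpone filter_uniq.
- by apply: postpone_by_due; exact: path_sorted sP.
- move=> q /mem_postpone[r rP [_ ->]] /=.
  have [ad aff] : arr r.1 <= due r.1 /\ affordable r.2 r.1.
    by apply: wfP; rewrite inE rP orbT.
  split=> //; case: ifP => // /andP[_ rj].
  have [S [satS le]] := aff; exists S; split=> //.
  by apply: le_trans le (leq_scale (leqW rj)).
Qed.

Lemma head_service_perm p P : well_formed (p :: P) ->
  perm_eq ((head_service p P).2 ++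
           [seq x <- [seq q.1 | q <- P] | x \notin (head_service p P).2])
          [seq q.1 | q <- p :: P].
Proof.
move=> wf; have [[pQ sub _] _ _] := head_serviceP wf.
have [uP _ _] := wf.
set Q := (head_service p P).2 in pQ sub *.
have subP : {subset Q <= [seq q.1 | q <- p :: P]}.
  move=> x /(mem_subseq sub) /mapP[q]; rewrite mem_filter => /andP[_ qP] ->.
  exact: map_f.
rewrite perm_sym -(perm_filterC (mem Q)) /= pQ /=.
rewrite -cat_cons; apply: perm_cat => //.
have -> : p.1 :: [seq x <- [seq q.1 | q <- P] | x \in Q] =
    [seq x <- [seq q.1 | q <- p :: P] | x \in Q] by rewrite /= pQ.
apply: uniq_perm; first exact: filter_uniq.
  apply: subseq_uniq sub _; rewrite /eligible.
  by apply: subseq_uniq uP; apply: map_subseq; exact: filter_subseq.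
by move=> x; rewrite mem_filter; case: (boolP (x \in Q)) => // /subP ->.
Qed.

Lemma run_serves n P : well_formed P -> (size P <= n)%N ->
  perm_eq (flatten [seq s.2.2 | s <- run n P]) [seq p.1 | p <- P] /\
  forall s x, s \in run n P -> x \in s.2.2 ->
    sat x s.2.1 /\ arr x <= s.1 <= due x.
Proof.
elim: n P => [|n IH] [|p P] // wf szP.
have [[pQ sub sv] _ _] := head_serviceP wf.
have [] := IH (postpone (due p.1) p.2 (head_service p P).2 P).
- exact: well_formed_postpone wf.
- rewrite size_map size_filter; exact: leq_trans (count_size _ _) (ltnSE szP).
move=> permP satP; split.
  apply: perm_trans (head_service_perm wf); rewrite /=.
  by rewrite perm_cat2l -(map_fst_postpone (due p.1) p.2).
move=> s x; rewrite inE => /predU1P[->|/satP h /h//] /= xQ; split.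
  by apply: sat_mono (sv _ xQ); exact: finset.subsetUr.
have /mapP[q] := mem_subseq sub xQ; rewrite mem_filter => /andP[/andP[qt _] qP] ->.
rewrite qt /=; have [_ sP _] := wf; move: qP; rewrite inE.
by move=> /predU1P[->//|]; exact: by_due_min.
Qed.

(** * Charging services to the offline solution *)

Variables (O : seq (R * {set E})) (kappa : X -> R).
Implicit Types (s b : nat -> R) (I : pred R).

Definition offline_served x : Prop :=
  exists o, [/\ o \in O, arr x <= o.1 <= due x, sat x o.2 & conn x o.2 <= kappa x].

(** What a service of level [j] may claim from [S]. The elements ignored cost at most [scale j / 4]
    together; the minimum makes the claims on an element decrease geometrically at scales below its
    cost. *)
Definition charge j S : R :=
  \sum_(e in S | scale j < 4 * #|E|.+1%:R * c e) Num.min (c e) (scale j).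

Definition offline_charge j I : R := \sum_(o <- O | I o.1) charge j o.2.

Definition bought I : {set E} := \bigcup_(o <- O | I o.1) o.2.

(** Open at [a], the time of the previous service, so that the windows charged by successive
    services at one level are disjoint. *)
Definition window (a d : R) : pred R := fun u => a < u <= d.

Lemma min_cost_ge0 j e : 0 <= Num.min (c e) (scale j).
Proof. by rewrite le_min c_ge0 ltW ?scale_gt0. Qed.

Lemma charge_ge0 j S : 0 <= charge j S.
Proof. by apply: sumr_ge0 => e _; exact: min_cost_ge0. Qed.

(** Either one element costs at least [scale j] and provides that amount alone, or no element is
    truncated. *)
Lemma charge_heavy j S (h : pred E) :
  (forall e, h e -> scale j < 4 * #|E|.+1%:R * c e) ->
  Num.min (\sum_(e in S | h e) c e) (scale j) <= charge j S.
Proof.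
move=> hh; have [e0 /andP[e0S he0]|small] :=
    @pickP _ [pred e | (e \in S) && (h e && (scale j <= c e))].
  have [h0 c0] := andP he0.
  apply: le_trans (_ : scale j <= _); first by rewrite ge_min lexx orbT.
  rewrite /charge (bigD1 e0) /=; last by rewrite e0S hh.
  rewrite (min_idPr c0) lerDl; apply: sumr_ge0 => e _; exact: min_cost_ge0.
rewrite ge_min; apply/orP; left.
rewrite /charge big_mkcond [leRHS]big_mkcond; apply: ler_sum => e _.
have := min_cost_ge0 j e; have := small e; rewrite /=.
case: (boolP (e \in S)) => //= eS; case: (boolP (h e)) => [he|] /=; last first.
  by case: ifP.
by rewrite hh // leNgt => /negbFE /ltW /min_idPl ->.
Qed.

Lemma charge_bought j I : charge j (bought I) <= offline_charge j I.
Proof.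
rewrite /bought /offline_charge; elim/big_rec2: _ => [|o S a _ le].
  by rewrite /charge big1 // => e; rewrite inE.
apply: le_trans (lerD (lexx _) le).
by apply: sum_setU_le => e; exact: min_cost_ge0.
Qed.

Lemma sub_bought o I : o \in O -> I o.1 -> o.2 \subset bought I.
Proof.
move=> oO Io; rewrite /bought; elim: O oO => // a L IH.
rewrite inE big_cons => /predU1P[<-|/IH sub]; first by rewrite Io finset.subsetUl.
by case: ifP => // _; apply: fintype.subset_trans sub _; exact: finset.subsetUr.
Qed.

Lemma offline_charge_sub j I (I' : pred R) : (forall u, I u -> I' u) ->
  offline_charge j I <= offline_charge j I'.
Proof.
move=> sub; rewrite /offline_charge big_mkcond [leRHS]big_mkcond.
apply: ler_sum => o _; have := charge_ge0 j o.2.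
by case: ifP => [/sub -> //|_]; case: ifP.
Qed.

Lemma offline_charge_split j (a t : R) : a <= t ->
  offline_charge j (fun u => a < u) =
  offline_charge j (window a t) + offline_charge j (fun u => t < u).
Proof.
move=> le_at; rewrite /offline_charge /window big_mkcond [X in _ = X + _]big_mkcond.
rewrite [X in _ = _ + X]big_mkcond -big_split; apply: eq_bigr => o _ /=.
case: (ltP t o.1) => [lt_to|_]; last by rewrite andbT addr0.
by rewrite (le_lt_trans le_at lt_to) add0r.
Qed.

Lemma kappa_ge0 x : offline_served x -> 0 <= kappa x.
Proof. by move=> [u [_ _ _]]; exact: le_trans. Qed.

(** All that is bought offline in the window serves [x], hence costs more than [scale j / 2],
    connection included. The elements ignored by [charge] account for at most half of this. *)
Lemma alone_charge j x a :
  (forall S, sat x S -> scale j < 2 * (set_cost S + conn x S)) ->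
  offline_served x -> a < arr x ->
  scale j <= 4 * (offline_charge j (window a (due x)) + kappa x).
Proof.
move=> costly srv ax; have k0 := kappa_ge0 srv.
have [ o [oO /andP[ao od] satx ck]] := srv.
have win : window a (due x) o.1 by rewrite /window od (lt_le_trans ax ao).
have := charge_bought j (window a (due x)).
set U := bought _ => chU.
have oU : o.2 \subset U by exact: sub_bought.
have := costly U (sat_mono oU satx).
have := conn_anti oU satx.
have := @charge_heavy j U (fun e => scale j < 4 * #|E|.+1%:R * c e) (fun _ => id).
have -> : set_cost U =
    \sum_(e in U | scale j < 4 * #|E|.+1%:R * c e) c e +
    \sum_(e in U | ~~ (scale j < 4 * #|E|.+1%:R * c e)) c e.
  by rewrite /set_cost (bigID (fun e => scale j < 4 * #|E|.+1%:R * c e)).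
have : \sum_(e in U | ~~ (scale j < 4 * #|E|.+1%:R * c e)) c e <= scale j / 4.
  apply: le_trans (_ : \sum_(e : E) scale j / 4 / #|E|.+1%:R <= _).
    rewrite big_mkcond; apply: ler_sum => e _.
    have s4 : 0 <= scale j / 4 by rewrite divr_ge0 // ltW ?scale_gt0.
    case: ifP; last by rewrite divr_ge0.
    by move=> /andP[_]; rewrite -leNgt ler_pdivlMr // => ?; nra.
  rewrite sumr_const -[_ *+ _]mulr_natl mulrA ler_pdivrMr // mulrC.
  by rewrite ler_pM2l ?ler_nat // divr_gt0 ?scale_gt0.
have := scale_gt0 j; rewrite minElt; case: ifP; lra.
Qed.

(** What is bought offline in the window serves all of [Q] at once. An element heavy at level [j]
    costs more than [scale j.+1 / (2 * #|E|.+1)], so [charge] counts it at level [j.+1]. *)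
Lemma joint_charge j Q (a d : R) :
  (forall z, z \in Q -> [/\ offline_served z, a < arr z & due z <= d]) ->
  (forall S, serves S Q -> scale j < residual j S Q) ->
  scale j.+1 <=
    4 * (offline_charge j.+1 (window a d) + \sum_(z <- Q) kappa z).
Proof.
move=> srv costly; have := charge_bought j.+1 (window a d).
set U := bought _ => chU.
have one z : z \in Q -> sat z U /\ conn z U <= kappa z.
  move=> /srv[[ o [oO /andP[ao od] satz ck]] az zd].
  have oU : o.2 \subset U.
    by apply: sub_bought oO _; rewrite /window (lt_le_trans az ao) (le_trans od zd).
  by split; [exact: sat_mono satz|apply: le_trans ck; exact: conn_anti].
have ksum : \sum_(z <- Q) conn z U <= \sum_(z <- Q) kappa z.
  by rewrite big_seq [leRHS]big_seq; apply: ler_sum => z /one[].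
have k0 : 0 <= \sum_(z <- Q) kappa z.
  by rewrite big_seq; apply: sumr_ge0 => z /srv[/kappa_ge0].
have := costly U (fun z zQ => (one z zQ).1).
have : Num.min (heavy_cost j U) (scale j.+1) <= charge j.+1 U.
  apply: charge_heavy => e lt; rewrite scaleS -mulrA.
  by have := scale_gt0 j; lra.
by have := scale_gt0 j; rewrite /residual scaleS minElt; case: ifP; lra.
Qed.

Definition costly j x : Prop :=
  forall S, sat x S -> scale j < 2 * (set_cost S + conn x S).

(** Why a service triggered by [p] is paid for: [p] is expensive alone, or a service that left it
    out has established the inequality. The latter requires release by time [s 0], the last service
    of any level, so later requests are of the first kind. *)
Definition certified s b (p : X * nat) : Prop :=
  costly p.2 p.1 \/
  arr p.1 <= s 0%N /\
  scale p.2 <= 4 * (offline_charge p.2 (window (s p.2) (due p.1)) + b p.2).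

(* [s j] is the time of the last service of level at least j, and [b j] is an
   amount of offline connection cost set aside for the next service of level j. *)
Definition accounted s b P : Prop :=
  [/\ well_formed P, forall i j, (i <= j)%N -> s j <= s i, forall j, 0 <= b j &
      forall p, p \in P -> [/\ offline_served p.1, s p.2 < arr p.1,
        s 0%N <= due p.1 & certified s b p]].

Definition last_after t j s : nat -> R := fun i => if (i <= j)%N then t else s i.

(** A service of level [j] spends the bank of its level and deposits the offline connection cost [k]
    of the requests it serves for level [j.+1]. *)
Definition bank_after j (k : R) b : nat -> R :=
  fun i => if i == j then 0 else if i == j.+1 then b i + k else b i.

Lemma accounted_postpone s b p P : accounted s b (p :: P) ->
  let Q := (head_service p P).2 in
  accounted (last_after (due p.1) p.2 s)
    (bank_after p.2 (\sum_(x <- Q) kappa x) b)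
    (postpone (due p.1) p.2 Q P).
Proof.
move=> [wf s_anti b0 acc] Q.
have [[pQ sub sv] _ skip] := head_serviceP wf; rewrite -/Q in pQ sub sv skip.
have [_ sP wfP] := wf.
have mem q : q \in P -> q \in p :: P by rewrite inE orbC => ->.
have elig z : z \in Q ->
    exists q, [/\ q \in p :: P, z = q.1, arr q.1 <= due p.1 & (q.2 <= p.2)%N].
  move=> /(mem_subseq sub) /mapP[q]; rewrite mem_filter.
  by move=> /andP[/andP[qt qj] qP] ->; exists q.
have k0 : 0 <= \sum_(x <- Q) kappa x.
  rewrite big_seq; apply: sumr_ge0 => z /elig[q [qP -> _ _]].
  by have [srv _ _ _] := acc q qP; exact: kappa_ge0.
have [_ _ s0t _] := acc p (mem_head _ _).
have st j : s j <= due p.1 by apply: le_trans (s_anti 0%N j _) s0t.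
split.
- exact: well_formed_postpone wf.
- move=> i j ij; rewrite /last_after; case: leqP => jp.
    by rewrite (leq_trans ij jp).
  by case: leqP => // _; exact: s_anti.
- by move=> j; rewrite /bank_after; do 2!case: ifP => // _; exact: addr_ge0.
move=> _ /mem_postpone[q qP [qQ ->]] /=.
have [srv sq s0q cert] := acc q (mem q qP).
have [aq _] := wfP q (mem q qP).
have tq : due p.1 <= due q.1 by exact: by_due_min sP _ qP.
(* If [q] was left out, the requests served are due no later than [q] and form an expensive list, so
   [joint_charge] certifies [q] at the next level. *)
case: ifP => [eq|/negbT neq].
  split=> //=.
    rewrite /last_after ltnn; apply: le_lt_trans sq; apply: s_anti.
    by case/andP: eq => _; exact: leqW.
  right; rewrite /last_after /= ltnn; split; first by case/andP: eq.
  have qA : q.1 \in eligible (due p.1) p.2 (p :: P).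
    by apply: map_f; rewrite mem_filter eq mem.
  have [Qq costlyQ] := skip _ qA qQ.
  apply: le_trans (joint_charge (a := s p.2.+1) (d := due q.1) _ costlyQ) _.
    move=> z zQ; have [u [uP zu _ up]] := elig z zQ; rewrite zu.
    have [? su _ _] := acc u uP; split=> //; last by rewrite -zu Qq.
    by apply: le_lt_trans su; apply: s_anti; exact: leqW.
  rewrite ler_pM2l // lerD2l /bank_after eqxx gtn_eqF //.
  by rewrite lerDr.
(* If [q] is not yet released, the start of its window may move up to [due p.1], still before its
   release, and [q] is [costly]. *)
have [tarr|arrt] := ltP (due p.1) (arr q.1).
  split=> //; first by rewrite /last_after; case: ifP.
  left; case: cert => // -[]; rewrite leNgt => /negP; case.
  exact: le_lt_trans s0t tarr.
(* The level of [q] is higher: its window is unchanged and the bank of its level can only grow. *)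
have pq : (p.2 < q.2)%N by move: neq; rewrite /is_eligible arrt /= -ltnNge.
split=> //.
  by rewrite /last_after leqNgt pq.
case: cert => [cost|[qs le]]; [by left|right; split].
  exact: le_trans qs s0t.
rewrite /last_after leqNgt pq /=; apply: le_trans le _.
rewrite ler_pM2l // lerD2l /bank_after gtn_eqF //; case: ifP => // _.
by rewrite lerDl.
Qed.

(** Offline actions count at a level only after its last service, since earlier ones may be charged
    already. The factor 2 lets the connection of a request be charged by the service that serves it
    and once more through the bank. *)
Definition potential K s b P : R :=
  \sum_(j < K) (offline_charge j (fun u => s j < u) + b j) +
  2 * \sum_(p <- P) kappa p.1.

Lemma sum_fst P : \sum_(p <- P) kappa p.1 = \sum_(x <- [seq p.1 | p <- P]) kappa x.
Proof. by rewrite big_map. Qed.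

Lemma offline_charge_ge0 j I : 0 <= offline_charge j I.
Proof. by apply: sumr_ge0 => o _; exact: charge_ge0. Qed.

(** The service uses up a window, the bank of its level and one copy of the connection costs of [Q],
    together worth at least [scale p.2 / 4]; the other copy is deposited. *)
Lemma potential_postpone K s b p P : accounted s b (p :: P) -> (p.2 < K)%N ->
  forall Q, Q = (head_service p P).2 ->
  scale p.2 / 4 + potential K (last_after (due p.1) p.2 s)
    (bank_after p.2 (\sum_(x <- Q) kappa x) b)
    (postpone (due p.1) p.2 Q P) <= potential K s b (p :: P).
Proof.
move=> acc pK Q defQ; have [wf s_anti b0 accP] := acc.
have [[pQ sub sv] _ _] := head_serviceP wf; rewrite -defQ in pQ sub sv.
have [srv sp s0t cert] := accP p (mem_head _ _).
have st j : s j <= due p.1 by apply: le_trans (s_anti 0%N j _) s0t.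
have kQ z : z \in Q -> 0 <= kappa z.
  move=> /(mem_subseq sub) /mapP[q]; rewrite mem_filter => /andP[_ qP] ->.
  by have [? _ _ _] := accP q qP; exact: kappa_ge0.
have kp : kappa p.1 <= \sum_(x <- Q) kappa x.
  rewrite (big_rem p.1) //= lerDl big_seq; apply: sumr_ge0 => z /mem_rem.
  exact: kQ.
have k0 : 0 <= \sum_(x <- Q) kappa x.
  by rewrite big_seq; apply: sumr_ge0.
have paid : scale p.2 <= 4 * (offline_charge p.2 (window (s p.2) (due p.1)) +
    b p.2 + \sum_(x <- Q) kappa x).
  case: cert => [cost|[_]].
    have := alone_charge cost srv sp; have := b0 p.2; lra.
  lra.
rewrite /potential !sum_fst map_fst_postpone -(perm_big _ (head_service_perm wf)).
rewrite -defQ big_cat mulrDr /=.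
set rest := \sum_(x <- [seq x <- _ | _]) _.
suff : \sum_(j < K) (offline_charge j (fun u => last_after (due p.1) p.2 s j < u) +
      bank_after p.2 (\sum_(x <- Q) kappa x) b j) +
    offline_charge p.2 (window (s p.2) (due p.1)) + b p.2 <=
    \sum_(j < K) (offline_charge j (fun u => s j < u) + b j) +
      \sum_(x <- Q) kappa x.
  lra.
(* Amounts of a single level are written as sums over all levels, to compare level by level. A
   deposit at level [K] falls outside the sum, whence only an inequality in [sumo]. *)
pose o (k : R) (i j : nat) := if i == j then k else 0.
have sumo k i : 0 <= k -> \sum_(j < K) o k j i <= k.
  move=> k_ge0; have [iK|Ki] := ltnP i K.
    rewrite (bigD1 (Ordinal iK)) //= /o eqxx big1 ?addr0 // => j ji.
    by rewrite ifN //; apply: contraNneq ji => ji; apply/eqP/val_inj.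
  by rewrite big1 // => j _; rewrite /o ltn_eqF // (leq_trans _ Ki).
have sump k : \sum_(j < K) o k j p.2 = k.
  rewrite (bigD1 (Ordinal pK)) //= /o eqxx big1 ?addr0 // => j jp.
  by rewrite ifN //; apply: contraNneq jp => jp; apply/eqP/val_inj.
rewrite -addrA -[X in _ + X <= _]sump.
apply: le_trans (lerD (lexx _) (sumo _ p.2.+1 k0)).
rewrite -!big_split; apply: ler_sum => j _ /=.
have bank : bank_after p.2 (\sum_(x <- Q) kappa x) b j + o (b p.2) j p.2 <=
    b j + o (\sum_(x <- Q) kappa x) j p.2.+1.
  rewrite /bank_after /o; case: eqVneq => [->|_].
    by rewrite ltn_eqF // add0r addr0.
  by case: eqP => _; rewrite addr0 // addr0.
have off : offline_charge j (fun u => last_after (due p.1) p.2 s j < u) +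
    o (offline_charge p.2 (window (s p.2) (due p.1))) j p.2 <=
    offline_charge j (fun u => s j < u).
  rewrite /last_after /o; case: eqVneq => [->|_].
    by rewrite leqnn addrC -offline_charge_split.
  rewrite addr0; case: ifP => // _; apply: offline_charge_sub => u.
  exact: le_lt_trans.
have -> : o (offline_charge p.2 (window (s p.2) (due p.1)) + b p.2) j p.2 =
    o (offline_charge p.2 (window (s p.2) (due p.1))) j p.2 + o (b p.2) j p.2.
  by rewrite /o; case: ifP => // _; rewrite addr0.
lra.
Qed.

Definition service_cost (v : R * ({set E} * seq X)) : R :=
  set_cost v.2.1 + \sum_(x <- v.2.2) conn x v.2.1.

(** A service of level [j] costs at most [3 * scale j], one part for light elements and two for the
    rest, and lowers the potential by [scale j / 4]: hence 12. A postponed request ends one level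
    above the trigger while [n] drops by one, so triggers stay below level [K]. *)
Lemma run_cost K n s b P : accounted s b P -> (size P <= n)%N ->
  (forall p, p \in P -> (p.2 + n <= K)%N) ->
  \sum_(v <- run n P) service_cost v <= 12 * potential K s b P.
Proof.
have pot0 m s' b' P' : accounted s' b' P' -> 0 <= 12 * potential m s' b' P'.
  move=> [_ _ b0 acc]; rewrite mulr_ge0 // addr_ge0 //.
    by apply: sumr_ge0 => j _; rewrite addr_ge0 // offline_charge_ge0.
  rewrite mulr_ge0 // big_seq; apply: sumr_ge0 => p /acc[srv _ _ _].
  exact: kappa_ge0.
elim: n s b P => [|n IH] s b [|p P] acc szP PK //=.
- by rewrite big_nil; exact: pot0 acc.
- by rewrite big_nil; exact: pot0 acc.
have pK : (p.2 < K)%N.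
  by apply: leq_trans (PK p (mem_head _ _)); rewrite addnS ltnS leq_addr.
rewrite big_cons.
have step := potential_postpone acc pK erefl.
have := IH _ _ _ (accounted_postpone acc); set P' := postpone _ _ _ _.
have szP' : (size P' <= n)%N.
  by rewrite size_map size_filter; exact: leq_trans (count_size _ _) (ltnSE szP).
have P'K q : q \in P' -> (q.2 + n <= K)%N.
  move=> /mem_postpone[r rP [_ ->]] /=.
  case: ifP => _; first by have := PK p (mem_head _ _); rewrite addnS.
  by apply: ltnW; rewrite -addnS; apply: PK; rewrite inE rP orbT.
move=> /(_ szP' P'K) rest.
have [wf _ _ _] := acc; have [[_ _ sv] res _] := head_serviceP wf.
suff : service_cost (due p.1, (light p.2 :|: (head_service p P).1,
    (head_service p P).2)%SET) <= 3 * scale p.2.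
  move: rest step; rewrite /P' /head_service; lra.
rewrite /service_cost /=.
have := set_cost_light p.2 (head_service p P).1.
have : \sum_(x <- (head_service p P).2) conn x (light p.2 :|: (head_service p P).1)%SET
    <= \sum_(x <- (head_service p P).2) conn x (head_service p P).1.
  rewrite big_seq [leRHS]big_seq; apply: ler_sum => z /sv.
  by apply: conn_anti; exact: finset.subsetUr.
by move: res; rewrite /residual; lra.
Qed.

(** * Initial levels and the complete algorithm *)

Hypothesis theta_min : forall x S,
  sat x S -> 0 < set_cost S + conn x S -> theta <= set_cost S + conn x S.

Definition zero_set : {set E} := [set e | c e == 0]%SET.

Definition is_free x : bool := `[< sat x zero_set /\ conn x zero_set = 0 >].

(** Non-anticipation is also demanded on infeasible inputs; requests that no schedule can serve are
    dropped there. *)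
Definition is_valid x : bool := (arr x <= due x) && `[< exists S, sat x S >].

Definition level x : nat := xget 0%N (fun j => affordable j x /\ costly j x).

Definition sort_due (P : seq (X * nat)) : seq (X * nat) :=
  sort (fun p q => due p.1 <= due q.1) P.

(* Requests that can be served at cost 0 have no level, since they are not
   [costly] at any scale: they are served at once. *)
Definition online_services (L : seq X) : seq (R * ({set E} * seq X)) :=
  [seq (arr x, (zero_set, [:: x])) | x <- L & is_valid x && is_free x] ++
  run (size L)
    (sort_due [seq (x, level x) | x <- L & is_valid x && ~~ is_free x]).

Lemma set_cost_zero_set : set_cost zero_set = 0.
Proof. by apply: big1 => e; rewrite inE => /eqP. Qed.

(** The least affordable level is costly: a positive one by minimality, level 0 because [theta] is
    at most every positive cost. Cost 0 would make [x] free, as a set of cost 0 lies in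
    [zero_set]. *)
Lemma levelP x : is_valid x -> ~~ is_free x ->
  affordable (level x) x /\ costly (level x) x.
Proof.
move=> /andP[_ /asboolP[S0 satS0]] notfree.
apply: (@xgetPex _ 0%N (fun j => affordable j x /\ costly j x)).
have pos S : sat x S -> 0 < set_cost S + conn x S.
  move=> satS; rewrite lt_neqAle addr_ge0 ?set_cost_ge0 // andbT eq_sym.
  apply: contraNneq notfree => cost0; apply/asboolP.
  have cS : set_cost S = 0.
    by apply/eqP; have := set_cost_ge0 S; have := conn_ge0 x S;
      rewrite eq_le => ? ?; apply/andP; split; lra.
  have subZ : S \subset zero_set.
    apply/fintype.subsetP => e eS; rewrite inE eq_le c_ge0 andbT -cS.
    rewrite /set_cost (bigD1 e) //= lerDl; exact: sumr_ge0.
  split; first exact: sat_mono satS.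
  apply/eqP; rewrite eq_le conn_ge0 andbT.
  by apply: le_trans (conn_anti subZ satS) _; rewrite cS in cost0; lra.
have aff : exists j, `[< affordable j x >].
  pose r := (set_cost S0 + conn x S0) / theta.
  exists (Num.truncn r).+1; apply/asboolP; exists S0; split=> //.
  rewrite /scale mulrC -ler_pdivrMr //; have := truncnS_gt r => /ltW /le_trans; apply.
  by rewrite -natrX ler_nat ltnW // ltn_expl.
have [[|j] /asboolP affj minj] := ex_minnP aff; [exists 0%N|exists j.+1];
  split=> // S satS.
  by have := theta_min satS (pos S satS); have := pos S satS; rewrite /scale expr0; lra.
rewrite scaleS ltr_pM2l // ltNge; apply/negP => le.
suff : (j.+1 <= j)%N by rewrite ltnn.
by apply: minj; apply/asboolP; exists S.
Qed.

Lemma sort_due_by_due P : by_due (sort_due P).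
Proof. by apply: sort_sorted => p q; apply: le_total. Qed.

Lemma online_services_online (L L' : seq X) t :
  [seq x <- L | arr x <= t] = [seq x <- L' | arr x <= t] ->
  [seq v <- online_services L | v.1 <= t] =
  [seq v <- online_services L' | v.1 <= t].
Proof.
move=> eqL; rewrite /online_services !filter_cat.
have swap (a : pred X) : [seq x <- [seq x <- L | a x] | arr x <= t] =
    [seq x <- [seq x <- L' | a x] | arr x <= t].
  have filterC M : [seq x <- [seq x <- M | a x] | arr x <= t] =
      [seq x <- [seq x <- M | arr x <= t] | a x].
    by rewrite -!filter_predI; apply: eq_filter => x; apply: andbC.
  by rewrite !filterC eqL.
congr (_ ++ _); first by rewrite !filter_map; congr map; exact: swap.
have bound (M : seq X) (a : pred X) :
    (size (sort_due [seq (x, level x) | x <- M & a x]) <= size M)%N.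
  by rewrite size_sort size_map size_filter count_size.
have valid (M : seq X) p :
    p \in sort_due [seq (x, level x) | x <- M & is_valid x && ~~ is_free x] ->
    arr p.1 <= due p.1.
  rewrite mem_sort => /mapP[x]; rewrite mem_filter.
  by move=> /andP[/andP[/andP[? _] _] _] ->.
apply: run_online; rewrite ?sort_due_by_due ?bound //; try exact: valid.
rewrite !filter_sort; try by [move=> ? ?; apply: le_total|exact: by_due_trans].
congr sort; rewrite !filter_map; congr map; exact: swap.
Qed.

Section OnlineServices.
Variable L : seq X.
Hypothesis uL : uniq L.
Hypothesis validL : forall x, x \in L -> is_valid x.

Let P0 := sort_due [seq (x, level x) | x <- L & is_valid x && ~~ is_free x].

Lemma map_fst_initial : perm_eq [seq p.1 | p <- P0] [seq x <- L | ~~ is_free x].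
Proof.
rewrite (perm_trans (perm_map _ (permEl (perm_sort _ _)))) // -map_comp map_id.
rewrite (@eq_in_filter _ _ (fun x => ~~ is_free x)) // => x /validL -> //.
Qed.

Lemma initial_well_formed : well_formed P0.
Proof.
split.
- by rewrite (perm_uniq map_fst_initial) filter_uniq.
- exact: sort_due_by_due.
move=> p; rewrite mem_sort => /mapP[x]; rewrite mem_filter.
move=> /andP[/andP[vx fx] _] -> /=; split; first by case/andP: vx.
by have [] := levelP vx fx.
Qed.

Lemma size_initial : (size P0 <= size L)%N.
Proof. by rewrite size_sort size_map size_filter count_size. Qed.

Lemma online_services_serve :
  perm_eq (flatten [seq v.2.2 | v <- online_services L]) L /\
  forall v x, v \in online_services L -> x \in v.2.2 ->
    sat x v.2.1 /\ arr x <= v.1 <= due x.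
Proof.
have [permP satP] := run_serves initial_well_formed size_initial.
split; last first.
  move=> v x; rewrite mem_cat => /orP[|/satP h /h//].
  move=> /mapP[y]; rewrite mem_filter => /andP[/andP[vy /asboolP[sy _]] _] -> /=.
  by rewrite inE => /eqP ->; split=> //; rewrite lexx; case/andP: vy.
rewrite /online_services map_cat flatten_cat -map_comp /=.
rewrite (eq_in_filter (a2 := is_free)); last by move=> x /validL ->.
have -> : flatten [seq [:: x] | x <- L & is_free x] = [seq x <- L | is_free x].
  exact: flatten_seq1.
apply: perm_trans (_ : perm_eq _
  ([seq x <- L | is_free x] ++ [seq x <- L | ~~ is_free x])) _.
  by rewrite perm_cat2l; apply: perm_trans permP map_fst_initial.
by rewrite perm_sym -(perm_filterC is_free).
Qed.

Lemma offline_charge_total K m (a : R) : 4 * #|E|.+1%:R <= 2 ^+ m :> R ->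
  \sum_(j < K) offline_charge j (fun u => a < u) <=
  (2 + m%:R) * \sum_(o <- O) set_cost o.2.
Proof.
move=> Em; apply: le_trans (_ : \sum_(j < K) \sum_(o <- O) charge j o.2 <= _).
  apply: ler_sum => j _; rewrite /offline_charge big_mkcond; apply: ler_sum => o _.
  by case: ifP => // _; exact: charge_ge0.
rewrite exchange_big mulr_sumr; apply: ler_sum => o _.
rewrite /charge /set_cost mulr_sumr.
under eq_bigr do rewrite big_mkcondr.
rewrite exchange_big; apply: ler_sum => e _.
by rewrite -big_mkcond; apply: sum_scales.
Qed.

Hypothesis offL : forall x, x \in L -> offline_served x.

Lemma online_services_cost m : 4 * #|E|.+1%:R <= 2 ^+ m :> R ->
  \sum_(v <- online_services L) service_cost v <=
  12 * (2 + m%:R) * (\sum_(o <- O) set_cost o.2 + \sum_(x <- L) kappa x).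
Proof.
move=> Em.
(* A time before all releases stands for the last service while there has been none. *)
have [a aL] : exists a, forall x, x \in L -> a < arr x.
  elim: (L) => [|x M [a aM]]; first by exists 0.
  exists (Num.min a (arr x - 1)) => y; rewrite inE => /predU1P[->|/aM ay].
    by rewrite gt_min ltrBlDr ltrDl ltr01 orbT.
  by rewrite gt_min ay.
pose top := (\max_(p <- P0) p.2 + size L)%N.
have inL p : p \in P0 -> [/\ p.1 \in L, is_valid p.1, ~~ is_free p.1 & p.2 = level p.1].
  by rewrite mem_sort => /mapP[x]; rewrite mem_filter => /andP[/andP[? ?] ?] ->.
have acc : accounted (fun=> a) (fun=> 0) P0.
  split=> //; first exact: initial_well_formed.
  move=> p /inL[pL vp fp pl]; have [ap _] := andP vp; have alt := aL _ pL.
  split=> //; first exact: offL.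
    by apply: le_trans ap; exact: ltW.
  by left; rewrite pl; have [] := levelP vp fp.
have topP p : p \in P0 -> (p.2 + size L <= top)%N.
  by move=> pP; rewrite leq_add2r; exact: leq_bigmax_seq.
have := run_cost acc size_initial topP.
have free0 : \sum_(x <- L | is_valid x && is_free x)
    service_cost (arr x, (zero_set, [:: x])) = 0.
  apply: big1 => x /andP[_ /asboolP[_ cx]].
  by rewrite /service_cost /= set_cost_zero_set big_seq1 cx addr0.
rewrite /online_services big_cat big_map big_filter free0 /= add0r.
move=> /le_trans; apply; rewrite -mulrA ler_pM2l //.
rewrite /potential /=; under eq_bigr do rewrite addr0.
have := offline_charge_total top a Em.
have kL : \sum_(p <- P0) kappa p.1 <= \sum_(x <- L) kappa x.
  rewrite sum_fst (perm_big _ map_fst_initial) big_filter big_mkcond.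
  rewrite big_seq [leRHS]big_seq; apply: ler_sum => x xL.
  by case: ifP => // _; apply: kappa_ge0; exact: offL.
have k0 : 0 <= \sum_(x <- L) kappa x.
  by rewrite big_seq; apply: sumr_ge0 => x xL; apply: kappa_ge0; exact: offL.
(* Connections are charged with factor 2 only; this slack allows the common factor [2 + m%:R]. *)
have : 0 <= m%:R * \sum_(x <- L) kappa x by rewrite mulr_ge0.
lra.
Qed.

End OnlineServices.

End Services.

(** * Competitive ratio *)

Section Ratio.
Variable R : realType.

(* A graph on n vertices has at most n ^ 2 edges, and at most n ^ 2 arcs. *)
Definition log_ratio (n : nat) : R := 12 * (2 + (up_log 2 (4 * (n ^ 2).+1))%:R).

Lemma log_ratio_gt0 n : 0 < log_ratio n.
Proof. by rewrite mulr_gt0 // ltr_wpDr. Qed.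

Lemma log_ratio_bigO : (log_ratio =O_\oo (fun n : nat => ln n%:R : R))%classic.
Proof.
(* From [2 ^ k.-1 < n ^ 5] follows [k * ln 2 <= ln 2 + 5 * ln n]; with [ln 2 <= ln n] this bounds
   [(2 + k) * ln 2] by [8 * ln n]. *)
apply/eqO_exP; exists (12 * (8 / ln 2)).
  by rewrite mulr_gt0 // divr_gt0 // ln_gt0 // ltr1n.
near=> n.
have n2 : (2 <= n)%N by near: n; exists 2%N.
have ln2 : 0 < ln 2 :> R by rewrite ln_gt0 // ltr1n.
have lnn : ln 2 <= ln n%:R :> R by rewrite ler_ln ?posrE ?ltr0n ?ler_nat //; lia.
rewrite ger0_norm ?(ltW (log_ratio_gt0 n)) // ger0_norm; last by lra.
rewrite /log_ratio -mulrA ler_pM2l // mulrAC ler_pdivlMr //.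
set k := up_log _ _.
have : (2 ^ k.-1 < n ^ 5)%N.
  have /andP[lt _] := @up_log_bounds 2 (4 * (n ^ 2).+1) isT (ltac:(lia)).
  apply: leq_trans lt _; rewrite (expnD n 3 2).
  have : (2 ^ 2 <= n ^ 2)%N by rewrite leq_exp2r.
  have : (2 ^ 3 <= n ^ 3)%N by rewrite leq_exp2r.
  by move: (n ^ 2)%N (n ^ 3)%N => a b; nia.
rewrite -(ltr_nat R) !natrX; move: (k) => {}k lt.
have n0 : (0 : R) < n%:R by rewrite ltr0n ltnW.
have : ln (2 ^+ k.-1 : R) <= ln (n%:R ^+ 5).
  by rewrite ler_ln ?posrE ?exprn_gt0 // ltW.
rewrite !lnXn // -[ln 2 *+ _]mulr_natl -[ln _ *+ 5]mulr_natl => le.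
have kk : (k%:R : R) * ln 2 <= (k.-1%:R + 1) * ln 2.
  by rewrite ler_pM2r // natr1 ler_nat leqSpred.
lra.
Unshelve. all: by end_near.
Qed.

(** A bound against each feasible schedule passes to the infimum, whether or not it is attained. *)
Lemma competitive_log_ratio (P : problem R) (A : algorithm P) n :
  (forall I s, chronological I -> feasible I s ->
     feasible I (A I) /\ cost I (A I) <= log_ratio n * cost I s) ->
  competitive (log_ratio n) A.
Proof.
move=> h I chI [s fs]; split; first by have [] := h I s chI fs.
rewrite mulrC -ler_pdivrMr ?log_ratio_gt0 //; apply: lb_le_inf.
  by exists (cost I s); exists s.
move=> _ [s' fs' <-]; rewrite ler_pdivrMr ?log_ratio_gt0 // mulrC.
by have [] := h I s' chI fs'.
Qed.

Lemma log_ratio_log_competitive (Inst : Type) (P : Inst -> problem R)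
    (size : Inst -> nat) :
  (forall I, exists A : algorithm (P I),
     online A /\ competitive (log_ratio (size I)) A) ->
  log_competitive P size.
Proof.
move=> h; exists log_ratio; split; first exact: log_ratio_bigO.
by exists (fun I => projT1 (cid (h I))) => I; exact: projT2 (cid (h I)).
Qed.

Lemma up_log_ratio m n : (m <= n ^ 2)%N ->
  4 * m.+1%:R <= 2 ^+ up_log 2 (4 * (n ^ 2).+1) :> R.
Proof.
move=> mn; rewrite -natrX -natrM ler_nat.
by apply: leq_trans _ (@up_logP 2 _ isT); rewrite leq_mul2l ltnS.
Qed.

Lemma min_positive (T : finType) (f : T -> R) :
  exists theta, 0 < theta /\ forall t, 0 < f t -> theta <= f t.
Proof.
suff [a [a0 le]] : exists a, 0 < a /\ forall t, t \in enum T -> 0 < f t -> a <= f t.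
  by exists a; split=> // t; apply: le; rewrite mem_enum.
elim: (enum T) => [|t s [a [a0 le]]]; first by exists 1.
have [ft|ft] := ltP 0 (f t).
  exists (Num.min a (f t)); split; first by rewrite lt_min a0.
  move=> u; rewrite inE => /predU1P[->|us] fu; first by rewrite ge_min lexx orbT.
  by rewrite ge_min le.
by exists a; split=> // u; rewrite inE => /predU1P[->|/le//]; rewrite ltNge ft.
Qed.

End Ratio.

(** * Requests tagged with their positions *)

Section Items.
Variables (R : realType) (Q : Type).
Implicit Types (I J : seq (timed R Q)) (t : R).

(* The position keeps equal requests apart. *)
Definition item : choiceType := {classic timed R Q * nat}.

Definition item_request (x : item) : timed R Q := (x : timed R Q * nat).1.
Definition position (x : item) : nat := (x : timed R Q * nat).2.
Definition item_release (x : item) : R := release (item_request x).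
Definition item_deadline (x : item) : R := deadline (item_request x).

Definition items I : seq item := zip I (iota 0 (size I)).

Lemma map_position I : [seq position x | x <- items I] = iota 0 (size I).
Proof. by rewrite /items -/unzip2 unzip2_zip // size_iota. Qed.

Lemma items_uniq I : uniq (items I).
Proof. by apply: (@map_uniq _ _ position); rewrite map_position iota_uniq. Qed.

Lemma items_onth I x :
  x \in items I <-> onth I (position x) = Some (item_request x).
Proof.
rewrite /items -[position x]subn0; move: (leq0n (position x)).
suff h m : (x \in (zip I (iota m (size I)) : seq item)) <->
    (m <= position x)%N /\ onth I (position x - m) = Some (item_request x).
  by move=> _; rewrite h; split=> [[]|].
elim: I m => [|q I IH] m /=; first by rewrite in_nil; split=> // -[_]; rewrite onth0n.
rewrite inE; split.
  case/predU1P => [->|/IH[mx]]; first by rewrite /position /= leqnn subnn.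
  rewrite subnS => h; split; first exact: ltnW.
  by rewrite -(prednK (_ : 0 < _ - m)%N) ?subn_gt0.
move=> [mx]; have [lt h|] := ltnP m (position x).
  apply/orP; right; apply/IH; split=> //.
  by move: h; rewrite subnS -{1}(prednK (_ : 0 < _ - m)%N) ?subn_gt0.
move=> xm; have {mx xm}e : position x = m by lia.
rewrite e subnn /= => -[qx]; apply/orP; left; apply/eqP.
by rewrite -e qx /item_request /position; case: (x).
Qed.

(** In chronological order the requests released by [t] form a prefix, so their positions do not
    depend on what follows. *)
Lemma items_revealed I J t :
  sorted (fun p q => release p <= release q) I ->
  sorted (fun p q => release p <= release q) J ->
  [seq q <- I | release q <= t] = [seq q <- J | release q <= t] ->
  [seq x <- items I | item_release x <= t] =
  [seq x <- items J | item_release x <= t].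
Proof.
have tr : transitive (fun p q : timed R Q => release p <= release q).
  by move=> ? ? ?; apply: le_trans.
have zipE K m : sorted (fun p q => release p <= release q) K ->
    [seq x <- (zip K (iota m (size K)) : seq item) | item_release x <= t] =
    zip [seq q <- K | release q <= t]
        (iota m (size [seq q <- K | release q <= t])).
  elim: K m => //= q K IH m sK; rewrite {1}/item_release /=.
  have sK' := path_sorted sK; rewrite IH //; case: (leP (release q) t) => // late.
  suff -> : [seq q <- K | release q <= t] = [::] by [].
  have := order_path_min tr sK; elim: (K) => //= p L IHL /andP[qp /IHL ->].
  by rewrite leNgt (lt_le_trans late qp).
by move=> sI sJ e; rewrite /items !zipE // e.
Qed.

End Items.

(** * Network design *)

Section NetworkDesign.
Variables (R : realType) (N : ND_instance R).

Definition item_sat (x : item R (nd_request N)) (S : {set elt N}) : Prop :=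
  sat (what (item_request x)) S.

(** Network design is the case without connection costs. *)
Definition ND_services (theta : R) (I : seq (timed R (nd_request N))) :=
  online_services (@elt_cost R N) (@item_release R _) (@item_deadline R _)
    item_sat (fun _ _ => 0) theta (items I).

Definition ND_algorithm (theta : R) : algorithm (ND N) :=
  fun I => [seq (v.1, v.2.1) | v <- ND_services theta I].

Lemma ND_algorithm_online theta : online (ND_algorithm theta).
Proof.
move=> I J t chI chJ eqIJ; rewrite /actions_until /ND_algorithm !filter_map.
by congr map; apply: online_services_online; exact: items_revealed.
Qed.

Lemma ND_log_ratio_competitive n : (#|elt N| <= n ^ 2)%N ->
  exists A : algorithm (ND N), online A /\ competitive (log_ratio R n) A.
Proof.
move=> Nn; have [theta [theta0 theta_min]] := min_positive (set_cost (@elt_cost R N)).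
exists (ND_algorithm theta); split; first exact: ND_algorithm_online.
apply: competitive_log_ratio => I s _ fs.
have up x (S T : {set elt N}) : S \subset T -> item_sat x S -> item_sat x T.
  exact: sat_up.
have tmin x (S : {set elt N}) : item_sat x S -> 0 < set_cost (@elt_cost R N) S + 0 ->
    theta <= set_cost (@elt_cost R N) S + 0.
  by rewrite addr0 => _; exact: theta_min.
have off x : x \in items I -> offline_served (@item_release R _)
    (@item_deadline R _) item_sat (fun _ _ => 0) s (fun=> 0) x.
  by move=> /items_onth /fs [u [us ut su]]; exists u; split.
have valid x : x \in items I -> is_valid (@item_release R _)
    (@item_deadline R _) item_sat x.
  move=> /off [u [_ /andP[ru ud] su _]]; rewrite /is_valid (le_trans ru ud).
  by apply/asboolP; exists u.2.
have [permQ satQ] := online_services_serve (@elt_cost_ge0 R N) (fun _ _ => lexx 0)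
  up (fun _ _ _ _ _ => lexx 0) theta0 tmin (items_uniq I) valid.
split.
  move=> i q Iq; have qI : ((q, i) : item R _) \in items I by apply/items_onth.
  move: (qI); rewrite -(perm_mem permQ) => /flattenP[_ /mapP[v vS ->] qv].
  have [sv tv] := satQ v _ vS qv.
  by exists (v.1, v.2.1); split=> //; apply/mapP; exists v.
have := online_services_cost (@elt_cost_ge0 R N) (fun _ _ => lexx 0)
  up (fun _ _ _ _ _ => lexx 0) theta0 tmin (items_uniq I) valid off (up_log_ratio R Nn).
rewrite [\sum_(x <- items I) _]big1 // addr0; apply: le_trans.
rewrite /cost /= /ND_cost big_map; apply: ler_sum => v _.
by rewrite /service_cost [\sum_(x <- v.2.2) _]big1 // addr0.
Qed.

End NetworkDesign.

(** * Sizes of edge sets, and sums over classes *)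

Lemma card_edge (G : sgraph) : (#|edge G| <= #|G| ^ 2)%N.
Proof.
rewrite card_sig; apply: leq_trans (_ : #|[set [set p.1; p.2] | p : G * G]%SET| <= _)%N.
  apply: subset_leq_card; apply/fintype.subsetP => e; rewrite !inE.
  move=> /existsP[x /existsP[y /andP[_ /eqP->]]].
  by apply/imsetP; exists (x, y).
by apply: leq_trans (leq_imset_card _ _) _; rewrite card_prod mulnn.
Qed.

Lemma card_arc (V : finType) (a : rel V) : (#|Defs.arc a| <= #|V| ^ 2)%N.
Proof. by rewrite card_sig -mulnn -card_prod max_card. Qed.

Lemma leq_sqr n : (n <= n ^ 2)%N.
Proof. by rewrite -mulnn; case: n => // n; rewrite leq_pmulr. Qed.

Lemma flatten_classes (T U : eqType) (K : finType) (f : T -> U) (g : T -> K)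
    (S : {set K}) (s : seq T) : (forall x, x \in s -> g x \in S) ->
  perm_eq (flatten [seq [seq f x | x <- s & g x == k] | k <- enum S])
          [seq f x | x <- s].
Proof.
move=> gS; apply/permP => a; rewrite count_flatten -map_comp sumnE big_map.
rewrite (eq_bigr (fun k => \sum_(x <- s) ((g x == k) && a (f x))))%N.
  rewrite exchange_big count_map -sum1_count [RHS]big_mkcond /=.
  rewrite big_seq [RHS]big_seq; apply: eq_bigr => x xs.
  rewrite big_enum (bigD1 (g x)) ?gS //= eqxx big1 ?addn0.
    by case: (a _).
  by move=> k /andP[_]; rewrite eq_sym => /negbTE ->.
move=> k _; rewrite /= count_map count_filter -sum1_count big_mkcond.
by apply: eq_bigr => x _ /=; rewrite andbC; case: (_ && _).
Qed.

Lemma sum_classes (R : realType) (T : eqType) (K : finType) (g : T -> K)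
    (F : K -> T -> R) (S : {set K}) (s : seq T) :
  (forall x, x \in s -> g x \in S) ->
  \sum_(k in S) \sum_(x <- s | g x == k) F k x = \sum_(x <- s) F (g x) x.
Proof.
move=> gS; under eq_bigr do rewrite big_mkcond.
rewrite exchange_big big_seq [RHS]big_seq; apply: eq_bigr => x xs.
rewrite (bigD1 (g x)) ?gS //= eqxx big1 ?addr0 // => k /andP[_].
by rewrite eq_sym => /negbTE ->.
Qed.

(** * Facility location *)

Section FacilityLocation.
Variables (R : realType) (G : facility_graph R).
Implicit Types (S T : {set G}) (v w : G).

Lemma dist_ge0 v w : 0 <= dist v w.
Proof.
rewrite /dist; set D := (X in inf X).
have [[d Dd]|/set0P/negP/negbNE/eqP ->] := pselect (D !=set0)%classic.
  apply: lb_le_inf; first by exists d.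
  move=> _ [p _ <-]; apply: sumr_ge0 => e _; case: insub => //= u.
  exact: weight_ge0.
by rewrite inf0.
Qed.

(** Connectivity is required because [dist] is 0 between different components. *)
Definition reaches w S v : bool := (v \in S) && connect (@adj G) v w.

Definition nearest S w : G :=
  if [pick v | reaches w S v] is Some v0
  then [arg min_(v < v0 | reaches w S v) dist v w]%O else w.

Lemma nearestP S w : (exists v, reaches w S v) ->
  reaches w S (nearest S w) /\
  forall v, reaches w S v -> dist (nearest S w) w <= dist v w.
Proof.
rewrite /nearest => -[v rv]; case: pickP => [v0 r0|/(_ v)]; last by rewrite rv.
by case: arg_minP => // u ru le.
Qed.

Definition reached (x : item R G) S : Prop :=
  exists v, reaches (what (item_request x)) S v.

Definition distance (x : item R G) S : R :=
  dist (nearest S (what (item_request x))) (what (item_request x)).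

Definition FL_services (theta : R) (I : seq (timed R G)) :=
  online_services (@opening_cost R G) (@item_release R _) (@item_deadline R _)
    reached distance theta (items I).

(** One action per vertex bought, even without requests, so that opening costs add up exactly to
    [set_cost]. *)
Definition openings (a : R * ({set G} * seq (item R G))) : seq (R * (G * seq nat)) :=
  [seq (a.1, (u, [seq position x | x <- a.2.2 &
                   nearest a.2.1 (what (item_request x)) == u])) | u <- enum a.2.1].

Definition FL_algorithm (theta : R) : algorithm (facility_location G) :=
  fun I => flatten [seq openings a | a <- FL_services theta I].

Lemma FL_algorithm_online theta : online (FL_algorithm theta).
Proof.
move=> I J t chI chJ eqIJ; rewrite /actions_until /FL_algorithm.
have flatE s : [seq x <- flatten [seq openings a | a <- s] | x.1 <= t] =
    flatten [seq openings a | a <- s & a.1 <= t].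
  rewrite filter_flatten -map_comp; elim: s => //= a s ->.
  rewrite filter_map (@eq_filter _ _ (fun=> a.1 <= t)) //.
  by case: ifP => _; rewrite ?filter_predT ?filter_pred0.
rewrite !flatE; congr (flatten (map _ _)).
by apply: online_services_online; exact: items_revealed.
Qed.

Lemma reached_mono x S T : S \subset T -> reached x S -> reached x T.
Proof.
move=> /fintype.subsetP ST [v /andP[vS vx]]; exists v.
by rewrite /reaches ST.
Qed.

Lemma distance_anti x S T : S \subset T -> reached x S -> distance x T <= distance x S.
Proof.
move=> ST xS; have [/andP[nS nx] _] := nearestP xS.
have [_] := nearestP (reached_mono ST xS); apply.
by rewrite /reaches nx (fintype.subsetP ST).
Qed.

Lemma distance1 x v : connect (@adj G) v (what (item_request x)) ->
  distance x [set v]%SET = dist v (what (item_request x)).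
Proof.
move=> vx; have [] := @nearestP [set v]%SET (what (item_request x)).
  by exists v; rewrite /reaches inE eqxx.
by rewrite /distance => /andP[/set1P -> _].
Qed.

Lemma uniq_flatten_mem (T : eqType) (ss : seq (seq T)) (s : seq T) :
  uniq (flatten ss) -> s \in ss -> uniq s.
Proof.
elim: ss => //= a ss IH; rewrite cat_uniq inE => /and3P[ua _ uss].
by move=> /predU1P[->//|]; exact: IH.
Qed.

Lemma sum_items (F : G -> R) (d : G) (I : seq (timed R G)) (l : seq nat) :
  uniq l -> {subset l <= iota 0 (size I)} ->
  \sum_(x <- items I | position x \in l) F (what (item_request x)) =
  \sum_(i <- l) F (nth d [seq what q | q <- I] i).
Proof.
move=> ul lI; have lE : perm_eq l [seq i <- iota 0 (size I) | i \in l].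
  apply: uniq_perm; rewrite ?filter_uniq ?iota_uniq // => i.
  by rewrite mem_filter; case: (boolP (i \in l)) => // /lI ->.
rewrite (perm_big _ lE) big_filter -map_position big_map.
rewrite big_seq_cond [RHS]big_seq_cond.
apply: eq_bigr => x /andP[/items_onth Ix _].
have Iw : onth [seq what q | q <- I] (position x) = Some (what (item_request x)).
  by rewrite onth_map Ix.
by rewrite -odflt_onth Iw.
Qed.

Lemma openings_perm (s : seq (R * ({set G} * seq (item R G)))) :
  (forall a x, a \in s -> x \in a.2.2 ->
     nearest a.2.1 (what (item_request x)) \in a.2.1) ->
  perm_eq (flatten [seq b.2.2 | b <- flatten [seq openings a | a <- s]])
          [seq position x | x <- flatten [seq a.2.2 | a <- s]].
Proof.
elim: s => //= a s IH near; rewrite map_cat flatten_cat map_cat.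
apply: perm_cat; last by apply: IH => b x bs; apply: near; rewrite inE bs orbT.
rewrite -map_comp; apply: flatten_classes => x.
by apply: near; rewrite mem_head.
Qed.

Lemma FL_log_ratio_competitive :
  exists A : algorithm (facility_location G),
    online A /\ competitive (log_ratio R #|G|) A.
Proof.
(* The distance of a request depends only on its vertex, so finitely many pairs determine a [theta]
   valid for all inputs. *)
have [theta [theta0 theta_min]] := min_positive (fun wS : G * {set G} =>
  set_cost (@opening_cost R G) wS.2 + dist (nearest wS.2 wS.1) wS.1).
exists (FL_algorithm theta); split; first exact: FL_algorithm_online.
apply: competitive_log_ratio => I s _ [perm_s feas_s].
have tmin x S : reached x S ->
    0 < set_cost (@opening_cost R G) S + distance x S ->
    theta <= set_cost (@opening_cost R G) S + distance x S.
  by move=> _; exact: (theta_min (what (item_request x), S)).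
(* Each offline opening becomes the purchase of one vertex; as [s] connects each request once,
   [kappa x] is the cost of connecting [x] in [s]. *)
pose O := [seq (a.1, [set a.2.1]%SET) | a <- s].
pose kappa (x : item R G) := \sum_(a <- s | position x \in a.2.2)
  dist a.2.1 (what (item_request x)).
have off x : x \in items I -> offline_served (@item_release R _)
    (@item_deadline R _) reached distance O kappa x.
  move=> xI; have Ix := (items_onth _ _).1 xI.
  have : position x \in flatten [seq a.2.2 | a <- s].
    by rewrite (perm_mem perm_s) -map_position map_f.
  move=> /flattenP[_ /mapP[a aS ->] xa].
  have [wa ca] := feas_s a _ _ aS xa Ix.
  exists (a.1, [set a.2.1]%SET); split=> //; first by apply/mapP; exists a.
    by exists a.2.1; rewrite /reaches inE eqxx.
  rewrite distance1 // /kappa (big_rem a) //= xa lerDl.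
  by apply: sumr_ge0 => ? _; exact: dist_ge0.
have valid x : x \in items I -> is_valid (@item_release R _)
    (@item_deadline R _) reached x.
  move=> /off [u [_ /andP[ru ud] su _]]; rewrite /is_valid (le_trans ru ud).
  by apply/asboolP; exists u.2.
have d0 x S : 0 <= distance x S by exact: dist_ge0.
have [permQ satQ] := online_services_serve (@opening_cost_ge0 R G) d0
  reached_mono distance_anti theta0 tmin (items_uniq I) valid.
have near a x : a \in FL_services theta I -> x \in a.2.2 ->
    nearest a.2.1 (what (item_request x)) \in a.2.1.
  by move=> aS xa; have [/nearestP[/andP[]]] := satQ a x aS xa.
split.
  split; first by rewrite -map_position; apply: perm_trans (openings_perm near)
    (perm_map _ permQ).
  move=> _ i q /flattenP[_ /mapP[a aS ->] /mapP[u _ ->]] /= /mapP[x].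
  rewrite mem_filter => /andP[/eqP xu xa] -> Ix.
  have xI : x \in items I.
    by rewrite -(perm_mem permQ); apply/flattenP; exists a.2.2 => //; exact: map_f.
  have := (items_onth _ _).1 xI; rewrite Ix => -[->].
  have [/nearestP[/andP[_ nx] _] ta] := satQ a x aS xa.
  by rewrite -xu.
have := online_services_cost (@opening_cost_ge0 R G) d0 reached_mono
  distance_anti theta0 tmin (items_uniq I) valid off (up_log_ratio R (leq_sqr _)).
have -> : \sum_(o <- O) set_cost (@opening_cost R G) o.2 +
    \sum_(x <- items I) kappa x = FL_cost I s.
  have -> : \sum_(x <- items I) kappa x =
      \sum_(a <- s) \sum_(x <- items I | position x \in a.2.2)
        dist a.2.1 (what (item_request x)).
    rewrite /kappa; under eq_bigr do rewrite big_mkcond.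
    by rewrite exchange_big; apply: eq_bigr => a _; rewrite -big_mkcond.
  rewrite /O big_map -big_split.
  rewrite big_seq [RHS]big_seq; apply: eq_bigr => a aS.
  rewrite /set_cost big_set1 (sum_items _ a.2.1) //.
    apply: uniq_flatten_mem (map_f (fun b => b.2.2) aS).
    by rewrite (perm_uniq perm_s) iota_uniq.
  move=> i ia; rewrite -(perm_mem perm_s).
  by apply/flattenP; exists a.2.2 => //; exact: map_f.
apply: le_trans; rewrite /cost /= /FL_cost /FL_algorithm big_flatten big_map.
rewrite big_seq [leRHS]big_seq; apply: ler_sum => a aS.
rewrite big_map big_enum big_split lerD2l /=.
rewrite /distance -(sum_classes (fun u x => dist u (what (item_request x)))
  (near a ^~ aS)).
apply: ler_sum => u _; rewrite big_map big_filter big_seq_cond [leRHS]big_seq_cond.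
rewrite le_eqVlt; apply/orP; left; apply/eqP.
apply: eq_bigr => x /andP[xa _].
have xI : x \in items I.
  by rewrite -(perm_mem permQ); apply/flattenP; exists a.2.2 => //; exact: map_f.
have Iw : onth [seq what q | q <- I] (position x) = Some (what (item_request x)).
  by rewrite onth_map ((items_onth _ _).1 xI).
by rewrite -odflt_onth Iw.
Qed.

End FacilityLocation.

Theorem theorem3p9 (R : realType) :
  log_competitive (fun N : ND_instance R => ND N) (fun N => #|elt N|) /\
  log_competitive (fun G : weighted_graph R => steiner_forest G)
    (fun G => #|G|) /\
  log_competitive (fun G : weighted_graph R => strong_steiner_forest G)
    (fun G => #|G|) /\
  log_competitive (fun G : weighted_graph R => multicut G)
    (fun G => #|G|) /\
  log_competitive (fun G : weighted_graph R => strong_multicut G)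
    (fun G => #|G|) /\
  log_competitive
    (fun G : node_weighted_graph R => node_weighted_steiner_forest G)
    (fun G => #|G|) /\
  log_competitive (fun G : weighted_graph R => steiner_network G)
    (fun G => #|G|) /\
  log_competitive (fun D : rooted_digraph R => directed_steiner_tree D)
    (fun D => #|D|) /\
  log_competitive (fun G : facility_graph R => facility_location G)
    (fun G => #|G|).
Proof.
repeat apply: conj; apply: log_ratio_log_competitive => G;
  try exact: FL_log_ratio_competitive; apply: ND_log_ratio_competitive;
  first [exact: leq_sqr|exact: card_edge|exact: card_arc].
Qed.
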